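(* Let $n\ge 0$, let $\lambda$ be a partition of $n+1$, and let $I\subset [n]=\{1,\dots,n\}$. Then the small Kostka number $\kappa_{\lambda,I}$ equals the number of standard Young tableaux $T$ of shape $\lambda$ with descent set $\mathrm{Des}(T)=I$.
   Context: Young diagrams are drawn in matrix (English) convention: rows are numbered from top to bottom, columns from left to right, and row $i$ of $\lambda=(\lambda_1\ge\dots\ge\lambda_k>0)$ has $\lambda_i$ boxes. A semi-standard Young tableau of shape $\lambda$ is a filling of the boxes by positive integers, weakly increasing along rows and strictly increasing down columns; its weight is $\beta=(\beta_1,\dots,\beta_k)$ where $\beta_i$ is the number of entries equal to $i$. A standard Young tableau is a semi-standard Young tableau of weight $(1,\dots,1)$. The Kostka number $K_{\lambda,\beta}$ is the number of semi-standard Young tableaux of shape $\lambda$ and weight $\beta$. For $J=\{j_1<\dots<j_r\}\subset[n]$ let $\varrho(J)=(j_1,j_2-j_1,\dots,j_r-j_{r-1},n+1-j_r)$, a composition of $n+1$ (with $\varrho(\emptyset)=(n+1)$). The small Kostka number of $\lambda$ and $I\subset[n]$ is $$\kappa_{\lambda,I}:=\sum_{J\subset I}(-1)^{|J|-|I|}K_{\lambda,\varrho(J)}.$$ For a standard Young tableau $T$ with $n+1$ boxes, $i\in[n]$ is a descent of $T$ if the row containing $i+1$ is (strictly) below the row containing $i$; $\mathrm{Des}(T)\subset[n]$ is the set of descents of $T$. *)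

(* Defs.v *)
From mathcomp Require Import all_boot all_order all_algebra.
Set Implicit Arguments.
Unset Strict Implicit.
Unset Printing Implicit Defensive.

Definition is_partition_of (m : nat) (la : seq nat) : bool :=
  [&& sorted geq la, 0 \notin la & sumn la == m].

(* Boxes are pairs (row, column), numbered from 0 downwards and rightwards. *)
Definition box (la : seq nat) : finType :=
  {i : 'I_(size la) & 'I_(nth 0 la i)}.

Definition row_of (la : seq nat) (b : box la) : nat := tag b.
Definition col_of (la : seq nat) (b : box la) : nat := tagged b.

Definition semistandard (la : seq nat) (T : box la -> nat) : bool :=
  [&& [forall b, 0 < T b],
      [forall b, forall c,
         (row_of b == row_of c) && (col_of b <= col_of c) ==> (T b <= T c)]
    & [forall b, forall c,
         (col_of b == col_of c) && (row_of b < row_of c) ==> (T b < T c)]].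

(* [nth 0 beta i] prescribes the number of entries equal to i + 1; no entry
   may exceed [size beta]. *)
Definition has_weight (la : seq nat) (T : box la -> nat) (beta : seq nat) :
    bool :=
  [forall b, T b <= size beta] &&
  [forall i : 'I_(size beta), #|[set b | T b == i.+1]| == nth 0 beta i].

(* Bounding the codomain only makes the type of fillings finite: the bound
   already follows from the weight condition. *)
Definition SSYT (la beta : seq nat) :
    {set {ffun box la -> 'I_(size beta).+1}} :=
  [set T : {ffun box la -> 'I_(size beta).+1} |
     semistandard (fun b => T b : nat) && has_weight (fun b => T b : nat) beta].

Definition Kostka (la beta : seq nat) : nat := #|SSYT la beta|.

Definition SYT (la : seq nat) := SSYT la (nseq (sumn la) 1).

(* Subsets of [n] = {1, ..., n} are encoded as {set 'I_n}: the ordinal i stands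
   for the integer i + 1. *)

(* [enum J] lists J in increasing order. *)
Definition varrho (n : nat) (J : {set 'I_n}) : seq nat :=
  pairmap (fun a b => b - a) 0 (rcons [seq (val j).+1 | j <- enum J] n.+1).

Definition Des (n : nat) (la : seq nat) (T : box la -> nat) : {set 'I_n} :=
  [set i : 'I_n | [exists b, exists c,
     [&& T b == i.+1, T c == i.+2 & row_of b < row_of c]]].

Local Open Scope ring_scope.

Definition small_Kostka (n : nat) (la : seq nat) (I : {set 'I_n}) : int :=
  \sum_(J : {set 'I_n} | J \subset I)
    (-1) ^ (#|J|%:Z - #|I|%:Z) * (Kostka la (varrho J))%:Z.

(* Main.v *)
(** Let J = {j_1 < ... < j_r} and s = (j_1, ..., j_r, n+1).  Replacing each entry
    of a standard tableau T by the index of its interval cut out by s gives an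
    array of weight varrho(J), and its columns are strict when Des(T) is included
    in J: without descents inside an interval, the boxes filled by that interval
    form a horizontal strip traversed from left to right.  Conversely a
    semistandard tableau of weight varrho(J) is standardized by ranking its boxes
    by entry, then by column.  Hence K_{la, varrho(J)} counts the standard
    tableaux T with Des(T) included in J, and the claim follows by
    inclusion-exclusion. *)

Require Import Defs.
From mathcomp Require Import all_boot all_order all_algebra.
From mathcomp Require Import zify.

Set Implicit Arguments.
Unset Strict Implicit.
Unset Printing Implicit Defensive.

(** * Compositions and their partial sums *)

Definition diffs (s : seq nat) : seq nat := pairmap (fun a b => b - a) 0 s.

Lemma size_diffs (s : seq nat) : size (diffs s) = size s.
Proof. exact: size_pairmap. Qed.

Lemma nth_diffs (s : seq nat) (i : nat) :
  i < size s -> nth 0 (diffs s) i = nth 0 s i - nth 0 (0 :: s) i.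
Proof. by move=> lt_is; rewrite (nth_pairmap 0). Qed.

(** Makes the weight (1, ..., 1) a difference sequence, so that standard and semistandard fillings
    share one weight criterion. *)
Lemma diffs_iota (m : nat) : diffs (iota 1 m) = nseq m 1.
Proof.
apply: (@eq_from_nth _ 0); rewrite size_diffs size_iota ?size_nseq // => i lt_im.
rewrite nth_diffs ?size_iota // nth_nseq lt_im nth_iota //.
by case: i lt_im => //= i /ltnW lt_im; rewrite nth_iota //; lia.
Qed.

(** The elements of [s] below [t] form a prefix, and an index lies outside it exactly when its entry
    reaches [t]. *)
Lemma count_ltn_leq (s : seq nat) (t i : nat) :
  sorted ltn s -> i < size s ->
  (count (fun x => x < t) s <= i) = (t <= nth 0 s i).
Proof.
elim: s i => //= x s IHs i xs.
have s_sorted := path_sorted xs.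
have small0 : t <= x -> count (fun y => y < t) s = 0.
  move=> le_tx; apply/eqP; rewrite -leqn0 leqNgt -has_count.
  apply/hasPn => y /(allP (order_path_min ltn_trans xs)); lia.
case: i => [|i] lt_is /=.
  by case: (leqP t x) => [/small0->|].
case: (leqP t x) => [le_tx|lt_xt]; last by rewrite add1n ltnS IHs.
rewrite small0 //; symmetry.
have := allP (order_path_min ltn_trans xs) _ (mem_nth 0 lt_is) => /=; lia.
Qed.

(** * Semistandard fillings, weights and boxes *)

Lemma semistandardP (la : seq nat) (T : box la -> nat) :
  reflect [/\ forall b, 0 < T b,
              forall b c, row_of b = row_of c -> col_of b <= col_of c ->
                T b <= T c
            & forall b c, col_of b = col_of c -> row_of b < row_of c ->
                T b < T c]
          (semistandard T).
Proof.
apply: (iffP and3P) => [[/forallP T0 /forallP Tr /forallP Tc]|[T0 Tr Tc]].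
  split=> // b c bc1 bc2.
    by apply: (implyP (forallP (Tr b) c)); rewrite bc1 eqxx.
  by apply: (implyP (forallP (Tc b) c)); rewrite bc1 eqxx.
split; first exact/forallP.
  apply/forallP=> b; apply/forallP=> c.
  by apply/implyP=> /andP[/eqP bc1 bc2]; apply: Tr.
apply/forallP=> b; apply/forallP=> c.
by apply/implyP=> /andP[/eqP bc1 bc2]; apply: Tc.
Qed.

Lemma card_leS (A : finType) (T : A -> nat) (i : nat) :
  #|[set b | T b <= i.+1]| = #|[set b | T b <= i]| + #|[set b | T b == i.+1]|.
Proof.
rewrite -cardsUI [X in _ = _ + X](_ : _ = 0) ?addn0.
  by apply: eq_card => b; rewrite !inE; lia.
by apply: eq_card0 => b; rewrite !inE; lia.
Qed.

(** Counts telescope into cumulative counts. The strict path keeps the truncated subtractions of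
    [diffs] exact, and the head of [0 :: s] is the count for bound 0. *)
Lemma has_weight_diffsP (la : seq nat) (T : box la -> nat) (s : seq nat) :
  path ltn 0 s -> (forall b, 0 < T b) ->
  reflect ((forall b, T b <= size s) /\
           forall i, i <= size s -> #|[set b | T b <= i]| = nth 0 (0 :: s) i)
          (has_weight T (diffs s)).
Proof.
move=> s_path T0.
have s_incr i : i < size s -> nth 0 (0 :: s) i < nth 0 s i.
  by move=> lt_is; apply: (pathP 0 s_path).
rewrite /has_weight size_diffs.
apply: (iffP andP) => [[/forallP le_T /forallP wT]|[le_T wT]]; split=> //.
- elim=> [_|i IHi lt_is] /=.
    by apply: eq_card0 => b; rewrite !inE; have := T0 b; lia.
  have /eqP := wT (Ordinal lt_is).
  rewrite /= nth_diffs // card_leS IHi ?(ltnW lt_is) // => ->.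
  by rewrite subnKC // ltnW // s_incr.
- exact/forallP.
apply/forallP=> -[i lt_is] /=; rewrite nth_diffs //; apply/eqP.
have := wT _ lt_is; rewrite card_leS wT ?(ltnW lt_is) //= => <-.
by rewrite addKn.
Qed.

Lemma corner_box (la : seq nat) (b c : box la) :
  sorted geq la -> row_of b <= row_of c ->
  exists d : box la, row_of d = row_of b /\ col_of d = col_of c.
Proof.
case: b c => [i j] [k l] la_sorted; rewrite /row_of /= => le_ik.
have lt_l : l < nth 0 la i.
  apply: leq_trans (ltn_ord l) _.
  by apply: (sorted_leq_nth (rev_trans leq_trans) leqnn 0 la_sorted);
    rewrite ?inE ?ltn_ord.
by exists (@Tagged _ i (fun i : 'I_(size la) => 'I_(nth 0 la i)) (Ordinal lt_l)).
Qed.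

(** * Destandardization, standardization and descents *)

(* [s] lists the partial sums of a weight; the entry [t] of a standard tableau
   becomes the index of the interval (s_(i-1), s_i] that contains it. *)
Definition destd (s : seq nat) (t : nat) : nat := (count (fun x => x < t) s).+1.

(** For a semistandard [S], equal entries lie in different columns, so this is a total order on
    boxes; [std] is the rank in it, counted from 1. *)
Definition std_le (la : seq nat) (S : box la -> nat) (c b : box la) : bool :=
  (S c < S b) || (S c == S b) && (col_of c <= col_of b).

Definition std (la : seq nat) (S : box la -> nat) (b : box la) : nat :=
  #|[set c | std_le S c b]|.

(** For [T] standard of size n+1 and [s = breaks J], this is the inclusion of Des(T) in J, phrased
    on entries to avoid ordinals. *)
Definition descents_in (la : seq nat) (T : box la -> nat) (s : seq nat) : Prop :=
  forall b c, T c = (T b).+1 -> row_of b < row_of c -> T b \in s.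

Lemma destd_mono (s : seq nat) (t u : nat) : t <= u -> destd s t <= destd s u.
Proof. by move=> le_tu; rewrite ltnS; apply: sub_count => x /=; lia. Qed.

Lemma destd_leS (s : seq nat) (t i : nat) :
  path ltn 0 s -> i < size s -> (destd s t <= i.+1) = (t <= nth 0 s i).
Proof. by move=> /path_sorted s_sorted lt_is; rewrite ltnS count_ltn_leq. Qed.

(** The two counts differ by the multiplicity of [t] in [s]. *)
Lemma destd_eqS (s : seq nat) (t : nat) : destd s t = destd s t.+1 -> t \notin s.
Proof.
move=> [eq_c]; apply/negP=> ts.
suff: count (fun x => x < t) s < count (fun x => x < t.+1) s by lia.
have -> : count (fun x => x < t.+1) s = count (fun x => x < t) s + count (pred1 t) s.
  rewrite -count_predUI [X in _ = _ + X](_ : _ = 0) ?addn0.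
    by apply: eq_count => x /=; lia.
  by rewrite -(count_pred0 s); apply: eq_count => x /=; lia.
by move: ts; rewrite -has_pred1 has_count; lia.
Qed.

(** * Standard fillings *)

Record standard (la : seq nat) (T : box la -> nat) : Prop := Standard {
  standard_ss : semistandard T;
  standard_le : forall b, T b <= sumn la;
  standard_card : forall i, i <= sumn la -> #|[set b | T b <= i]| = i
}.

Lemma standardP (la : seq nat) (T : box la -> nat) :
  reflect (standard T) (semistandard T && has_weight T (nseq (sumn la) 1)).
Proof.
(* Both facts read [0 :: iota 1 m] as [iota 0 m.+1], to which it is convertible. *)
have iota_path : path ltn 0 (iota 1 (sumn la)) := iota_ltn_sorted 0 (sumn la).+1.
have nth_iota0 i : i <= sumn la -> nth 0 (0 :: iota 1 (sumn la)) i = i.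
  by move=> lei; rewrite -[_ :: _]/(iota 0 (sumn la).+1) nth_iota.
rewrite -diffs_iota; apply: (iffP andP) => [[ssT]|[ssT le_T cT]].
  have [T0 _ _] := semistandardP _ ssT.
  move=> /(has_weight_diffsP iota_path T0); rewrite size_iota => -[le_T cT].
  by split=> // i lei; rewrite cT ?nth_iota0.
split=> //; have [T0 _ _] := semistandardP _ ssT.
apply/(has_weight_diffsP iota_path T0); rewrite size_iota.
by split=> // i lei; rewrite cT ?nth_iota0.
Qed.

Lemma standard_card1 (la : seq nat) (T : box la -> nat) (i : nat) :
  standard T -> i < sumn la -> #|[set b | T b == i.+1]| = 1.
Proof.
case=> _ _ cT lti; have := card_leS T i.
by rewrite !cT ?(ltnW lti) //; lia.
Qed.

Lemma standard_inj (la : seq nat) (T : box la -> nat) :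
  standard T -> injective T.
Proof.
move=> stT b c Tbc; have [/semistandardP[T0 _ _] le_T _] := stT.
have /eqP/cards1P[d dE] : #|[set x | T x == (T b).-1.+1]| = 1.
  by apply: standard_card1 => //; have := T0 b; have := le_T b; lia.
have mem x : T x = T b -> x = d.
  by move=> Tx; apply/set1P; rewrite -dE inE Tx prednK.
by rewrite (mem b) // (mem c).
Qed.

Lemma standard_surj (la : seq nat) (T : box la -> nat) (t : nat) :
  standard T -> 0 < t <= sumn la -> exists b, T b = t.
Proof.
move=> stT /andP[t0 le_t].
have /eqP/cards1P[d dE] : #|[set x | T x == t.-1.+1]| = 1.
  by apply: standard_card1 => //; lia.
by exists d; apply/eqP; have := set11 d; rewrite -dE inE prednK.
Qed.

(** * From standard to semistandard fillings *)

(** Induction on [T c - T b]: passing from one entry to the next inside an interval of [s] meets no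
    descent, so the row index never increases. *)
Lemma destd_row (la s : seq nat) (T : box la -> nat) (b c : box la) :
  standard T -> descents_in T s -> T b <= T c ->
  destd s (T b) = destd s (T c) -> row_of c <= row_of b.
Proof.
move=> stT desT le_bc.
have [/semistandardP[T0 _ _] le_T _] := stT.
move: (subnKC le_bc); move: (T c - T b) => k.
elim: k c {le_bc} => [|k IHk] c Tc eq_d.
  by rewrite (standard_inj stT (_ : T c = T b)) // -Tc addn0.
have [d Td] : exists d, T d = T b + k.
  by apply: standard_surj => //; have := T0 b; have := le_T c; lia.
have d1 : destd s (T b) <= destd s (T d) by apply: destd_mono; lia.
have d2 : destd s (T d) <= destd s (T c) by apply: destd_mono; lia.
have le_db : row_of d <= row_of b by apply: IHk; lia.
rewrite leqNgt; apply/negP => lt_bc.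
have Tcd : T c = (T d).+1 by lia.
have /negP[] : T d \notin s by apply: destd_eqS; rewrite -Tcd; lia.
by apply: (desT d c); lia.
Qed.

(* If c were weakly left of b, the box in the row of c and the column of b would
   carry an entry between T c and T b. *)
Lemma destd_col (la s : seq nat) (T : box la -> nat) (b c : box la) :
  sorted geq la -> standard T -> descents_in T s -> T b < T c ->
  destd s (T b) = destd s (T c) -> col_of b < col_of c.
Proof.
move=> la_sorted stT desT lt_bc eq_d.
have le_r := destd_row stT desT (ltnW lt_bc) eq_d.
have [/semistandardP[_ Tr Tc] _ _] := stT.
rewrite ltnNge; apply/negP=> le_c.
have [d [rd cd]] := corner_box la_sorted le_r.
have le_cd : T c <= T d by apply: Tr; lia.
suff: T d <= T b by lia.
case: (ltngtP (row_of d) (row_of b)) => [lt_r|lt_r|eq_r]; last by apply: Tr; lia.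
  by apply/ltnW/Tc.
by lia.
Qed.

(** Rows survive because [destd s] is monotone; a tie in a column would put two entries of one
    interval in the same column, against [destd_col]. *)
Lemma destd_semistandard (la s : seq nat) (T : box la -> nat) :
  sorted geq la -> standard T -> descents_in T s ->
  semistandard (fun b => destd s (T b)).
Proof.
move=> la_sorted stT desT; have [/semistandardP[_ Tr Tc] _ _] := stT.
apply/semistandardP; split=> // b c bc1 bc2; first exact/destd_mono/Tr.
have lt_bc := Tc _ _ bc1 bc2.
have := destd_mono s (ltnW lt_bc); rewrite leq_eqVlt => /predU1P[eq_d|//].
by have := destd_col la_sorted stT desT lt_bc eq_d; rewrite bc1 ltnn.
Qed.

Lemma destd_le_size (s : seq nat) (t : nat) :
  path ltn 0 s -> 0 < t <= last 0 s -> destd s t <= size s.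
Proof.
(* For empty [s] the default value [last 0 s = 0] contradicts [0 < t]. *)
case/lastP: s => [|s x] s_path; first by rewrite /=; lia.
rewrite last_rcons size_rcons => /andP[_ le_tx].
by rewrite destd_leS ?size_rcons // nth_rcons ltnn eqxx.
Qed.

Lemma destd_weight (la s : seq nat) (T : box la -> nat) :
  path ltn 0 s -> last 0 s = sumn la -> standard T ->
  has_weight (fun b => destd s (T b)) (diffs s).
Proof.
move=> s_path s_last [/semistandardP[T0 _ _] le_T cT].
apply/has_weight_diffsP => //; split=> [b|[|i] lei /=].
- by apply: destd_le_size; rewrite ?s_last ?T0 ?le_T.
- by apply: eq_card0 => b; rewrite !inE.
rewrite -[RHS]cT.
  by apply: eq_card => b; rewrite !inE destd_leS.
rewrite -s_last -nth_last.
move/path_sorted: s_path => s_sorted.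
have [-> //|ne_i] := eqVneq i (size s).-1.
by apply/ltnW/(sorted_ltn_nth ltn_trans 0 s_sorted); rewrite ?inE; lia.
Qed.

(** Inside an interval [T] increases with the column, so [std_le] orders the boxes as [T] does, and
    the rank of [b] counts the entries up to [T b]. *)
Lemma std_destd (la s : seq nat) (T : box la -> nat) (b : box la) :
  sorted geq la -> standard T -> descents_in T s ->
  std (fun b => destd s (T b)) b = T b.
Proof.
move=> la_sorted stT desT; have [_ le_T cT] := stT.
rewrite -[RHS]cT ?le_T //; apply: eq_card => c; rewrite !inE /std_le.
case: (ltngtP (T c) (T b)) => [lt_cb|lt_bc|/(standard_inj stT)->]; last first.
- by rewrite eqxx leqnn orbT.
- have := destd_mono s (ltnW lt_bc); rewrite leq_eqVlt => /predU1P[eq_d|]; last by lia.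
  by have := destd_col la_sorted stT desT lt_bc eq_d; lia.
have := destd_mono s (ltnW lt_cb); rewrite leq_eqVlt => /predU1P[eq_d|]; last by lia.
by have := destd_col la_sorted stT desT lt_cb eq_d; lia.
Qed.

(** * From semistandard to standard fillings *)

Lemma std_le_mono (la : seq nat) (S : box la -> nat) (b c : box la) :
  std_le S b c -> std S b <= std S c.
Proof.
move=> le_bc; apply/subset_leq_card/subsetP => d; rewrite !inE.
by move: le_bc; rewrite /std_le; lia.
Qed.

(** By totality [b] precedes [c], and [c] itself is counted only in its own rank. *)
Lemma std_lt_mono (la : seq nat) (S : box la -> nat) (b c : box la) :
  ~~ std_le S c b -> std S b < std S c.
Proof.
move=> nle_cb; apply/proper_card/properP; split; last first.
  by exists c; rewrite !inE //; rewrite /std_le; lia.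
apply/subsetP => d; rewrite !inE.
by move: nle_cb; rewrite /std_le; lia.
Qed.

Lemma semistandard_box_inj (la : seq nat) (S : box la -> nat) (b c : box la) :
  semistandard S -> S b = S c -> col_of b = col_of c -> b = c.
Proof.
move=> /semistandardP[_ _ Sc] Sbc col_bc.
have row_bc : row_of b = row_of c.
  by case: (ltngtP (row_of b) (row_of c)) => // lt_r;
    [have := Sc _ _ col_bc lt_r | have := Sc _ _ (esym col_bc) lt_r]; lia.
case: b c row_bc col_bc {Sbc} => [i j] [k l]; rewrite /row_of /col_of /=.
(* The type of the column depends on the row, so the rows are identified first. *)
move=> /val_inj ik; case: _ / ik l => l jl.
by congr Tagged; apply: val_inj.
Qed.

Lemma std_inj (la : seq nat) (S : box la -> nat) :
  semistandard S -> injective (std S).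
Proof.
move=> ssS b c eq_bc.
have le_bc : std_le S b c.
  by apply: contraT => /std_lt_mono; rewrite eq_bc ltnn.
have le_cb : std_le S c b.
  by apply: contraT => /std_lt_mono; rewrite eq_bc ltnn.
by apply: (semistandard_box_inj ssS); move: le_bc le_cb; rewrite /std_le; lia.
Qed.

(** Boxes are counted through the weight rather than the shape: all entries are at most [size s],
    where the cumulative count is the last partial sum. *)
Lemma weight_card (la s : seq nat) (S : box la -> nat) :
  path ltn 0 s -> semistandard S -> has_weight S (diffs s) ->
  #|box la| = last 0 s.
Proof.
move=> s_path /semistandardP[S0 _ _] /(has_weight_diffsP s_path S0)[le_S cS].
rewrite (last_nth 0) -cS // -cardsT.
by apply: eq_card => b; rewrite !inE le_S.
Qed.

Lemma std_standard (la s : seq nat) (S : box la -> nat) :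
  path ltn 0 s -> last 0 s = sumn la ->
  semistandard S -> has_weight S (diffs s) -> standard (std S).
Proof.
move=> s_path s_last ssS wS.
have card_box := weight_card s_path ssS wS; rewrite s_last in card_box.
have [S0 Sr Sc] := semistandardP _ ssS.
have std_gt0 b : 0 < std S b.
  by apply/card_gt0P; exists b; rewrite inE /std_le eqxx leqnn orbT.
have std_max b : std S b <= sumn la by rewrite -card_box max_card.
split=> //.
  apply/semistandardP; split=> // b c bc1 bc2.
    by apply: std_le_mono; have := Sr _ _ bc1 bc2; rewrite /std_le; lia.
  by apply: std_lt_mono; have := Sc _ _ bc1 bc2; rewrite /std_le; lia.
(* Ranks start at 1, hence the predecessor. As an injection between sets of equal size, [f] is
   bijective, so exactly [i] boxes have rank at most [i]. *)
pose f b : 'I_(sumn la) := Ordinal (n := sumn la) (m := (std S b).-1)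
  (leq_trans (eq_leq (prednK (std_gt0 b))) (std_max b)).
have f_inj : injective f.
  move=> b c /(congr1 val) /= eq_bc; apply: (std_inj ssS).
  by have := std_gt0 b; have := std_gt0 c; lia.
move=> i lei.
have [g fK gK] : bijective f by apply: inj_card_bij => //; rewrite card_ord card_box.
have widen_inj : injective (widen_ord lei).
  by move=> x y /(congr1 val) /= /val_inj.
rewrite -[RHS](card_ord i) -(card_imset _ widen_inj).
rewrite -(card_imset _ f_inj); apply: eq_card => x.
apply/imsetP/imsetP => [[b]|[y _ ->]].
  rewrite inE => le_b ->; have := std_gt0 b => b0.
  have lt_b : (std S b).-1 < i by lia.
  by exists (Ordinal lt_b) => //; apply: val_inj.
exists (g (widen_ord lei y)); rewrite ?gK // inE.
have := congr1 val (gK (widen_ord lei y)) => /=.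
by have := ltn_ord y; lia.
Qed.

Lemma destd_std (la s : seq nat) (S : box la -> nat) (b : box la) :
  path ltn 0 s -> last 0 s = sumn la ->
  semistandard S -> has_weight S (diffs s) -> destd s (std S b) = S b.
Proof.
move=> s_path s_last ssS wS.
have [/semistandardP[T0 _ _] le_T _] := std_standard s_path s_last ssS wS.
have [S0 _ _] := semistandardP _ ssS.
have [le_S cS] := has_weight_diffsP s_path S0 wS.
(* The boxes with entry at most [i.+1] form an initial segment of the rank order with [nth 0 s i]
   elements; [b] lies in it exactly when its rank is at most that number. *)
have destd_le i : i < size s -> (destd s (std S b) <= i.+1) = (S b <= i.+1).
  move=> lt_is; rewrite destd_leS // -[nth 0 s i]/(nth 0 (0 :: s) i.+1) -cS //.
  case: (leqP (S b) i.+1) => [le_Si|lt_iS].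
    apply/subset_leq_card/subsetP => c; rewrite !inE /std_le; lia.
  apply/negbTE; rewrite -ltnNge; apply/proper_card/properP; split.
    apply/subsetP => c; rewrite !inE /std_le; lia.
  by exists b; rewrite !inE /std_le; lia.
have le_d : destd s (std S b) <= size s.
  by apply: destd_le_size; rewrite ?s_last ?T0 ?le_T.
have := S0 b; have := le_S b => leSb S0b.
(* Taking for [i.+1] each side of the goal in turn gives the two opposite inequalities. *)
have := destd_le (destd s (std S b)).-1.
have := destd_le (S b).-1.
have : 0 < destd s (std S b) by [].
by lia.
Qed.

Lemma std_descents (la s : seq nat) (S : box la -> nat) :
  sorted geq la -> path ltn 0 s -> last 0 s = sumn la ->
  semistandard S -> has_weight S (diffs s) -> descents_in (std S) s.
Proof.
move=> la_sorted s_path s_last ssS wS b c Tbc lt_r.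
apply: contraT => nTs.
(* No break separates the consecutive ranks of [b] and [c], so destandardizing them gives the same
   entry. *)
have eq_S : S b = S c.
  rewrite -(destd_std b s_path s_last ssS wS) -(destd_std c s_path s_last ssS wS) Tbc.
  congr _.+1; apply: eq_in_count => x xs /=.
  have : x != std S b by apply: contraNneq nTs => <-.
  by lia.
have [_ Sr Sc] := semistandardP _ ssS.
have le_c : col_of b <= col_of c.
  have : std_le S b c by apply: contraT => /std_lt_mono; rewrite Tbc; lia.
  by rewrite /std_le; lia.
(* The box in the row of [b] and the column of [c] forces [S b <= S d < S c], against the
   equality. *)
have [d [rd cd]] := corner_box la_sorted (ltnW lt_r).
have : S b <= S d by apply: Sr; lia.
have : S d < S c by apply: Sc; lia.
by lia.
Qed.

Lemma eq_semistandard (la : seq nat) (T U : box la -> nat) :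
  T =1 U -> semistandard T = semistandard U.
Proof.
move=> eqTU; rewrite /semistandard; congr [&& _, _ & _].
- by apply: eq_forallb => b; rewrite eqTU.
- by apply: eq_forallb => b; apply: eq_forallb => c; rewrite !eqTU.
- by apply: eq_forallb => b; apply: eq_forallb => c; rewrite !eqTU.
Qed.

Lemma eq_has_weight (la beta : seq nat) (T U : box la -> nat) :
  T =1 U -> has_weight T beta = has_weight U beta.
Proof.
move=> eqTU; rewrite /has_weight; congr (_ && _).
  by apply: eq_forallb => b; rewrite eqTU.
apply: eq_forallb => i; congr (_ == _).
by apply: eq_card => b; rewrite !inE eqTU.
Qed.

Lemma eq_standard (la : seq nat) (T U : box la -> nat) :
  T =1 U -> standard T -> standard U.
Proof.
move=> eqTU /standardP; rewrite (eq_semistandard eqTU) (eq_has_weight _ eqTU).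
by move/standardP.
Qed.

(** * Kostka numbers as counts of standard tableaux *)

(** The partial sums of [varrho J]: by conversion, [varrho J] is [diffs (breaks J)]. *)
Definition breaks (n : nat) (J : {set 'I_n}) : seq nat :=
  rcons [seq (val j).+1 | j <- enum J] n.+1.

Lemma last_breaks (n : nat) (J : {set 'I_n}) : last 0 (breaks J) = n.+1.
Proof. exact: last_rcons. Qed.

Lemma breaks_path (n : nat) (J : {set 'I_n}) : path ltn 0 (breaks J).
Proof.
have val_sorted : sorted ltn [seq val j | j <- enum J].
  rewrite sorted_map {1}/enum_mem -enumT; apply: sorted_filter.
    by move=> x y z; apply: ltn_trans.
  by rewrite -[sorted _ _]sorted_map val_enum_ord iota_ltn_sorted.
rewrite /breaks -cats1 cat_path /= andbT; apply/andP; split.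
  rewrite (path_sortedE ltn_trans); apply/andP; split.
    by apply/allP=> x /mapP[j _ ->].
  by rewrite sorted_map; rewrite sorted_map in val_sorted.
have := mem_last 0 [seq (val j).+1 | j <- enum J].
rewrite inE => /predU1P[->//|/mapP[j _ ->]].
by rewrite ltnS ltn_ord.
Qed.

(** The final break n+1 adds no admissible descent, since descents are at most n. *)
Lemma Des_subset (n : nat) (la : seq nat) (T : box la -> nat) (J : {set 'I_n}) :
  sumn la = n.+1 -> standard T ->
  Des n T \subset J <-> descents_in T (breaks J).
Proof.
move=> sum_la [/semistandardP[T0 _ _] le_T _].
split=> [/subsetP desJ b c Tc lt_bc|desT].
  have lt_n : (T b).-1 < n by have := T0 b; have := le_T c; lia.
  have /desJ jJ : Ordinal lt_n \in Des n T.
    rewrite inE; apply/existsP; exists b; apply/existsP; exists c => /=.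
    by rewrite Tc prednK // !eqxx.
  rewrite mem_rcons inE; apply/orP; right.
  by apply/mapP; exists (Ordinal lt_n); rewrite ?mem_enum //= prednK.
apply/subsetP => j; rewrite inE.
move=> /existsP[b /existsP[c /and3P[/eqP Tb /eqP Tc lt_bc]]].
have := desT b c; rewrite Tb => /(_ Tc lt_bc).
rewrite mem_rcons inE => /predU1P[[] jn|/mapP[k]].
  by have := ltn_ord j; rewrite jn ltnn.
by rewrite mem_enum => kJ [/val_inj->].
Qed.

Lemma Kostka_varrho (n : nat) (la : seq nat) (J : {set 'I_n}) :
  is_partition_of n.+1 la ->
  Kostka la (varrho J) =
    #|[set T in SYT la | Des n (fun b => nat_of_ord (T b)) \subset J]|.
Proof.
case/and3P=> la_sorted _ /eqP sum_la.
set s := breaks J; rewrite -[varrho J]/(diffs s).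
have s_path : path ltn 0 s by apply: breaks_path.
have s_last : last 0 s = sumn la by rewrite last_breaks.
(* [inord] only fits the values into the finite codomain; [FE] shows that it leaves them unchanged
   on [A]. *)
pose F (T : {ffun box la -> 'I_(size (nseq (sumn la) 1)).+1}) :
    {ffun box la -> 'I_(size (diffs s)).+1} :=
  [ffun b => inord (destd s (T b))].
set A := [set T in SYT la | _].
have AP (T : {ffun box la -> 'I_(size (nseq (sumn la) 1)).+1}) :
    reflect (standard (fun b => T b : nat) /\
    descents_in (fun b => T b : nat) s) (T \in A).
  rewrite !inE; apply: (iffP andP) => [[/standardP stT]|[stT]].
    by move/(Des_subset _ sum_la stT).
  by move=> desT; split; [apply/standardP | apply/(Des_subset _ sum_la stT)].
have FE T b : T \in A -> F T b = destd s (T b) :> nat.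
  case/AP=> [[/semistandardP[T0 _ _] le_T _] _]; rewrite ffunE inordK // ltnS.
  by rewrite size_diffs destd_le_size ?s_last ?T0 ?le_T.
(* [std] recovers [T] from the entries of [F T] alone. *)
have F_inj : {in A &, injective F}.
  move=> T U TA UA eqF; apply/ffunP=> b; apply: val_inj => /=.
  have [[stT desT] [stU desU]] := (AP _ TA, AP _ UA).
  rewrite -(std_destd b la_sorted stT desT) -(std_destd b la_sorted stU desU).
  apply: eq_card => c; rewrite !inE /std_le.
  by rewrite -!FE // eqF.
rewrite -(card_in_imset F_inj); apply: eq_card => S.
apply/idP/imsetP => [|[T TA ->]]; last first.
  have [stT desT] := AP _ TA.
  rewrite inE (eq_semistandard (fun b => FE _ b TA)).
  rewrite (eq_has_weight _ (fun b => FE _ b TA)).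
  by rewrite destd_semistandard ?destd_weight.
rewrite inE => /andP[ssS wS].
have stS := std_standard s_path s_last ssS wS.
pose T : {ffun box la -> 'I_(size (nseq (sumn la) 1)).+1} :=
  [ffun b => inord (std (fun b => S b : nat) b)].
have TE b : T b = std (fun b => S b : nat) b :> nat.
  by rewrite ffunE inordK // ltnS size_nseq; apply: (standard_le stS).
have TA : T \in A.
  apply/AP; split; first by apply: eq_standard stS => b; rewrite TE.
  move=> b c; rewrite !TE.
  exact: (std_descents la_sorted s_path s_last ssS wS).
exists T => //; apply/ffunP=> b; apply: val_inj => /=.
by rewrite FE // TE destd_std.
Qed.

(** * Inclusion-exclusion *)

Local Open Scope ring_scope.
Import GRing.Theory.

(** Möbius inversion on the Boolean lattice. The exponent |J| + |I| has the parity of |J| - |I| and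
    stays a natural number. *)
Lemma sum_sign_interval (U : finType) (D I : {set U}) :
  \sum_(J : {set U} | (D \subset J) && (J \subset I)) (-1) ^+ (#|J| + #|I|) =
    (D == I)%:R :> int.
Proof.
have [<-{I}|neqDI] := eqVneq D I.
  rewrite (big_pred1 D) => [|J]; first by rewrite addnn -mul2n exprM sqrrN !expr1n.
  by rewrite -eqEsubset eq_sym.
have [subDI|nsubDI] := boolP (D \subset I); last first.
  rewrite big_pred0 // => J; apply: contraNF nsubDI => /andP[].
  exact: subset_trans.
have [x xI xD] : exists2 x, x \in I & x \notin D.
  by apply/subsetPn; apply: contraNN neqDI => subID; rewrite eqEsubset subDI.
pose flip (J : {set U}) := if x \in J then J :\ x else x |: J.
have flipK : involutive flip.
  move=> J; rewrite /flip; case: (boolP (x \in J)) => xJ.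
    by rewrite !inE eqxx /= setD1K.
  by rewrite setU11 setU1K.
(* Toggling x is a sign-reversing involution of the interval [D, I]. *)
set S := LHS; suff : S = - S by lia.
rewrite /S {1}(reindex_inj (inv_inj flipK)) -sumrN; apply: eq_big => J.
  rewrite /flip; case: ifP => xJ.
    rewrite subsetD1 xD andbT; congr (_ && _).
    by rewrite -[in RHS](setD1K xJ) subUset sub1set xI.
  rewrite subUset sub1set xI; congr (_ && _).
  by rewrite -[in RHS](setU1K (negbT xJ)) subsetD1 xD andbT.
move=> _; rewrite /flip; case: ifP => xJ; last first.
  by rewrite cardsU1 xJ addSn exprS mulN1r.
by rewrite [in RHS](cardsD1 x) xJ addSn exprS mulN1r opprK.
Qed.

Theorem theorem3p5p1 (n : nat) (la : seq nat) (I : {set 'I_n}) :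
  is_partition_of n.+1 la ->
  small_Kostka la I =
    Posz #|[set T in SYT la | Des n (fun b => nat_of_ord (T b)) == I]|.
Proof.
move=> part_la; rewrite /small_Kostka.
pose D (T : {ffun box la -> 'I_(size (nseq (sumn la) 1%N)).+1}) :=
  Des n (fun b => nat_of_ord (T b)).
transitivity (\sum_(J : {set 'I_n} | J \subset I)
    \sum_(T in SYT la | D T \subset J) (-1) ^+ (#|J| + #|I|) : int).
  apply: eq_bigr => J _.
  (* The factor of exponent -|I| equals its inverse, and the product with the Kostka number becomes
     a constant sum over tableaux. *)
  rewrite (Kostka_varrho J part_la) exprzDr ?unitrN1 // -exprnN invr_sign.
  rewrite -exprD -mulrzz -pmulrn -sumr_const.
  by apply: eq_bigl => T; rewrite inE.
(* After the exchange, the inner sum for [T] runs over the sets J between [D T] and [I]. *)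
rewrite (exchange_big_dep (mem (SYT la))) /=; last by move=> J T _ /andP[].
transitivity (\sum_(T in SYT la) (D T == I)%:R : int).
  apply: eq_bigr => T TS; rewrite -sum_sign_interval; apply: eq_bigl => J.
  by rewrite TS andbC.
rewrite -[RHS]natz -sum1_card natr_sum (eq_bigl _ _ (in_set _)) [RHS]big_mkcondr /=.
by apply: eq_bigr => T _; rewrite /D; case: eqP.
Qed.
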